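(* Let $\mathcal{A}$ be an abelian category with enough projectives, let $\mathcal{B}$ be an abelian category with enough injectives, and let $\mathrm{F}\colon\mathcal{A}\rightleftarrows\mathcal{B}\colon\mathrm{G}$ be an adjunction with $\mathrm{F}$ left adjoint of $\mathrm{G}$. For any $X\in\mathsf{Fix}_0(\mathcal{A})$ and any integer $d\geq 0$, the equivalence $\mathrm{F}\colon\mathsf{Fix}_0(\mathcal{A})\rightleftarrows\mathsf{coFix}_0(\mathcal{B})\colon\mathrm{G}$ restricts to an equivalence $$\mathrm{F}\colon\ \mathsf{Fix}_0(\mathcal{A})\cap\mathsf{res}^{\mathcal{A}}_d(X) \ \rightleftarrows\ \mathsf{res}^{\mathcal{B}}_d(\mathrm{F}X)\ \colon\mathrm{G}.$$ If $\mathrm{G}(B)=0$ implies $B=0$ (for any $B\in\mathcal{B}$), then $\mathsf{res}^{\mathcal{A}}_d(X)\subseteq\mathsf{Fix}_0(\mathcal{A})$, and hence the equivalence takes the simpler form $\mathsf{res}^{\mathcal{A}}_d(X)\rightleftarrows\mathsf{res}^{\mathcal{B}}_d(\mathrm{F}X)$.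
   Context: $\mathrm{L}_i\mathrm{F}$ and $\mathrm{R}^i\mathrm{G}$ denote the $i$-th left derived functor of $\mathrm{F}$ and the $i$-th right derived functor of $\mathrm{G}$; $\eta$ and $\varepsilon$ denote the unit and counit of $(\mathrm{F},\mathrm{G})$. $\mathsf{Fix}_0(\mathcal{A})$ is the full subcategory of $\mathcal{A}$ of objects $A$ such that $\mathrm{L}_i\mathrm{F}(A)=0$ for all $i>0$, $\mathrm{R}^i\mathrm{G}(\mathrm{F}(A))=0$ for all $i>0$, and $\eta_A\colon A\to\mathrm{G}\mathrm{F}(A)$ is an isomorphism. $\mathsf{coFix}_0(\mathcal{B})$ is the full subcategory of $\mathcal{B}$ of objects $B$ such that $\mathrm{R}^i\mathrm{G}(B)=0$ for all $i>0$, $\mathrm{L}_i\mathrm{F}(\mathrm{G}(B))=0$ for all $i>0$, and $\varepsilon_B\colon\mathrm{F}\mathrm{G}(B)\to B$ is an isomorphism. The functors $\mathrm{F}$ and $\mathrm{G}$ restrict to an adjoint equivalence between $\mathsf{Fix}_0(\mathcal{A})$ and $\mathsf{coFix}_0(\mathcal{B})$. For an object $X$ in an abelian category $\mathcal{C}$, $\mathrm{add}_{\mathcal{C}}(X)$ is the class of direct summands of finite direct sums of copies of $X$. For $d\geq 0$, $\mathsf{res}^{\mathcal{C}}_d(X)$ is the full subcategory of objects $C\in\mathcal{C}$ for which there is an exact sequence $0\to X_d\to\cdots\to X_0\to C\to 0$ with $X_0,\ldots,X_d\in\mathrm{add}_{\mathcal{C}}(X)$. *)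

(* Defs.v *)
From mathcomp Require Import all_boot all_algebra.
From Stdlib Require Import ClassicalEpsilon.

Set Implicit Arguments.
Unset Strict Implicit.
Unset Printing Implicit Defensive.

Import GRing.Theory.
Local Open Scope ring_scope.

Declare Scope cat_scope.
Delimit Scope cat_scope with cat.
Local Open Scope cat_scope.

Record category := Category {
  ob :> Type;
  hom : ob -> ob -> zmodType;
  idm : forall x, hom x x;
  comp : forall x y z, hom y z -> hom x y -> hom x z;
  comp1m : forall x y (f : hom x y), comp (idm y) f = f;
  compm1 : forall x y (f : hom x y), comp f (idm x) = f;
  compA : forall x y z t (h : hom z t) (g : hom y z) (f : hom x y),
    comp h (comp g f) = comp (comp h g) f;
  compDl : forall x y z (g g' : hom y z) (f : hom x y),
    comp (g + g') f = comp g f + comp g' f;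
  compDr : forall x y z (g : hom y z) (f f' : hom x y),
    comp g (f + f') = comp g f + comp g f' }.

Arguments hom {c} x y.
Arguments idm {c} x.
Arguments comp {c x y z} g f.

Notation "g ∘ f" := (comp g f) (at level 40, left associativity) : cat_scope.

Section InCategory.
Variable C : category.

Lemma comp0m (x y z : C) (f : hom x y) : (0 : hom y z) ∘ f = 0.
Proof. by apply: (addrI (0 ∘ f)); rewrite -compDl !addr0. Qed.

Lemma compm0 (x y z : C) (g : hom y z) : g ∘ (0 : hom x y) = 0.
Proof. by apply: (addrI (g ∘ 0)); rewrite -compDr !addr0. Qed.

Definition is_iso (x y : C) (f : hom x y) : Prop :=
  exists g : hom y x, g ∘ f = idm x /\ f ∘ g = idm y.

Definition isomorphic (x y : C) : Prop := exists f : hom x y, is_iso f.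

Definition mono (x y : C) (m : hom x y) : Prop :=
  forall z (f g : hom z x), m ∘ f = m ∘ g -> f = g.

Definition epi (x y : C) (e : hom x y) : Prop :=
  forall z (f g : hom y z), f ∘ e = g ∘ e -> f = g.

(* Initial and terminal: hom-sets are groups, hence inhabited by 0. *)
Definition is_zero (x : C) : Prop :=
  (forall y (f : hom x y), f = 0) /\ (forall y (f : hom y x), f = 0).

Definition is_kernel (x y : C) (f : hom x y) (k : C) (i : hom k x) : Prop :=
  f ∘ i = 0 /\
  forall z (g : hom z x), f ∘ g = 0 -> exists! u : hom z k, i ∘ u = g.

Definition is_cokernel (x y : C) (f : hom x y) (c : C) (p : hom y c) : Prop :=
  p ∘ f = 0 /\
  forall z (g : hom y z), g ∘ f = 0 -> exists! u : hom c z, u ∘ p = g.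

Definition projective (p : C) : Prop :=
  forall x y (e : hom x y), epi e ->
  forall f : hom p y, exists g : hom p x, e ∘ g = f.

Definition injective (q : C) : Prop :=
  forall x y (m : hom y x), mono m ->
  forall f : hom y q, exists g : hom x q, g ∘ m = f.

Definition enough_projectives : Prop :=
  forall x : C, exists (p : C) (e : hom p x), projective p /\ epi e.

Definition enough_injectives : Prop :=
  forall x : C, exists (q : C) (m : hom x q), injective q /\ mono m.

End InCategory.

(* No additivity is required here; see [left_adjoint_additive]. *)
Record functor (C D : category) := Functor {
  fob :> C -> D;
  fmap : forall x y : C, hom x y -> hom (fob x) (fob y);
  fmap1 : forall x : C, fmap (idm x) = idm (fob x);
  fmapM : forall (x y z : C) (g : hom y z) (f : hom x y),
    fmap (g ∘ f) = fmap g ∘ fmap f }.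

Arguments fmap {C D} f {x y} _ : rename.

Definition additive_functor (C D : category) (F : functor C D) : Prop :=
  forall (x y : C) (f g : hom x y), fmap F (f + g) = fmap F f + fmap F g.

(* [F] is left adjoint to [G]. *)
Record adjunction (C D : category) (F : functor C D) (G : functor D C) :=
  Adjunction {
  unit_of : forall x : C, hom x (G (F x));
  counit_of : forall y : D, hom (F (G y)) y;
  unit_nat : forall (x x' : C) (f : hom x x'),
    unit_of x' ∘ f = fmap G (fmap F f) ∘ unit_of x;
  counit_nat : forall (y y' : D) (g : hom y y'),
    counit_of y' ∘ fmap F (fmap G g) = g ∘ counit_of y;
  triangleL : forall x : C, counit_of (F x) ∘ fmap F (unit_of x) = idm (F x);
  triangleR : forall y : D, fmap G (counit_of y) ∘ unit_of (G y) = idm (G y) }.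

Definition adjoint_equivalence (C D : category) (F : functor C D)
    (G : functor D C) (adj : adjunction F G) : Prop :=
  (forall x, is_iso (unit_of adj x)) /\ (forall y, is_iso (counit_of adj y)).

Definition full (C : category) (P : C -> Prop) : category :=
  @Category {x : C | P x} (fun x y => hom (sval x) (sval y))
    (fun x => idm (sval x)) (fun x y z g f => g ∘ f)
    (fun x y => @comp1m C (sval x) (sval y))
    (fun x y => @compm1 C (sval x) (sval y))
    (fun x y z t => @compA C (sval x) (sval y) (sval z) (sval t))
    (fun x y z => @compDl C (sval x) (sval y) (sval z))
    (fun x y z => @compDr C (sval x) (sval y) (sval z)).

Definition restrict_functor (C D : category) (F : functor C D)
    (P : C -> Prop) (Q : D -> Prop) (hF : forall x, P x -> Q (F x)) :
    functor (full P) (full Q) :=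
  @Functor (full P) (full Q)
    (fun x => exist Q (F (sval x)) (hF (sval x) (svalP x)))
    (fun x y => @fmap C D F (sval x) (sval y))
    (fun x => fmap1 F (sval x))
    (fun x y z => @fmapM C D F (sval x) (sval y) (sval z)).

Definition restrict_adjunction (C D : category) (F : functor C D)
    (G : functor D C) (adj : adjunction F G) (P : C -> Prop) (Q : D -> Prop)
    (hF : forall x, P x -> Q (F x)) (hG : forall y, Q y -> P (G y)) :
    adjunction (restrict_functor hF) (restrict_functor hG) :=
  @Adjunction (full P) (full Q) (restrict_functor hF) (restrict_functor hG)
    (fun x => unit_of adj (sval x))
    (fun y => counit_of adj (sval y))
    (fun x x' => @unit_nat _ _ _ _ adj (sval x) (sval x'))
    (fun y y' => @counit_nat _ _ _ _ adj (sval y) (sval y'))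
    (fun x => triangleL adj (sval x))
    (fun y => triangleR adj (sval y)).

(* The equivalence that [adj] induces between [full P] and [full Q] restricts
   to an equivalence between the full subcategories given by [P'] and [Q']. *)
Definition restricts_to_equivalence (C D : category) (F : functor C D)
    (G : functor D C) (adj : adjunction F G)
    (P : C -> Prop) (Q : D -> Prop) (P' : C -> Prop) (Q' : D -> Prop) : Prop :=
  (forall x, P' x -> P x) /\ (forall y, Q' y -> Q y) /\
  exists (hF : forall x, P' x -> Q' (F x)) (hG : forall y, Q' y -> P' (G y)),
    adjoint_equivalence (restrict_adjunction adj hF hG).

Record abelian := Abelian {
  ab_cat :> category;
  zero_ob : ab_cat;
  zero_obP : is_zero zero_ob;
  bip : ab_cat -> ab_cat -> ab_cat;
  inl_m : forall x y, hom x (bip x y);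
  inr_m : forall x y, hom y (bip x y);
  prl_m : forall x y, hom (bip x y) x;
  prr_m : forall x y, hom (bip x y) y;
  prl_inl : forall x y, prl_m x y ∘ inl_m x y = idm x;
  prr_inr : forall x y, prr_m x y ∘ inr_m x y = idm y;
  prl_inr : forall x y, prl_m x y ∘ inr_m x y = 0;
  prr_inl : forall x y, prr_m x y ∘ inl_m x y = 0;
  bip_id : forall x y,
    inl_m x y ∘ prl_m x y + inr_m x y ∘ prr_m x y = idm (bip x y);
  ker : forall x y : ab_cat, hom x y -> ab_cat;
  kerm : forall (x y : ab_cat) (f : hom x y), hom (ker f) x;
  kermP : forall (x y : ab_cat) (f : hom x y), is_kernel f (kerm f);
  coker : forall x y : ab_cat, hom x y -> ab_cat;
  cokerm : forall (x y : ab_cat) (f : hom x y), hom y (coker f);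
  cokermP : forall (x y : ab_cat) (f : hom x y), is_cokernel f (cokerm f);
  mono_normal : forall (x y : ab_cat) (m : hom x y), mono m ->
    exists (z : ab_cat) (f : hom y z), is_kernel f m;
  epi_normal : forall (x y : ab_cat) (e : hom x y), epi e ->
    exists (z : ab_cat) (f : hom z x), is_cokernel f e }.

Arguments zero_ob {a}.
Arguments bip {a} x y.
Arguments inl_m {a} x y.
Arguments inr_m {a} x y.
Arguments prl_m {a} x y.
Arguments prr_m {a} x y.
Arguments ker {a x y} f.
Arguments kerm {a x y} f.
Arguments coker {a x y} f.
Arguments cokerm {a x y} f.

Definition op_cat (C : category) : category :=
  @Category C (fun x y => @hom C y x) (fun x => idm x)
    (fun x y z g f => comp (c := C) f g)
    (fun x y => @compm1 C y x) (fun x y => @comp1m C y x)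
    (fun x y z t h g f => esym (@compA C t z y x f g h))
    (fun x y z g g' f => @compDr C z y x f g g')
    (fun x y z g f f' => @compDl C z y x f f' g).

Lemma op_is_zero (C : category) (x : C) :
  is_zero x -> is_zero (x : op_cat C).
Proof. by case. Qed.

Definition op (A : abelian) : abelian :=
  @Abelian (op_cat A) (@zero_ob A) (op_is_zero (@zero_obP A)) (@bip A)
    (@prl_m A) (@prr_m A) (@inl_m A) (@inr_m A)
    (@prl_inl A) (@prr_inr A) (@prr_inl A) (@prl_inr A) (@bip_id A)
    (fun x y (f : @hom A y x) => coker f)
    (fun x y (f : @hom A y x) => cokerm f)
    (fun x y => @cokermP A y x)
    (fun x y (f : @hom A y x) => ker f)
    (fun x y (f : @hom A y x) => kerm f)
    (fun x y => @kermP A y x)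
    (fun x y => @epi_normal A y x) (fun x y => @mono_normal A y x).

Definition op_functor (C D : category) (F : functor C D) :
    functor (op_cat C) (op_cat D) :=
  @Functor (op_cat C) (op_cat D) F (fun x y => @fmap C D F y x)
    (fmap1 F) (fun x y z g f => @fmapM C D F z y x f g).

Lemma op_functor_additive (C D : category) (F : functor C D) :
  additive_functor F -> additive_functor (op_functor F).
Proof. by move=> aF x y; apply: aF. Qed.

Definition op_adjunction (C D : category) (F : functor C D) (G : functor D C)
    (adj : adjunction F G) : adjunction (op_functor G) (op_functor F) :=
  @Adjunction (op_cat D) (op_cat C) (op_functor G) (op_functor F)
    (counit_of adj) (unit_of adj)
    (fun x x' f => esym (@counit_nat _ _ _ _ adj x' x f))
    (fun y y' g => esym (@unit_nat _ _ _ _ adj y' y g))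
    (triangleR adj) (triangleL adj).

Lemma additive_functor0 (C D : category) (F : functor C D) :
  additive_functor F -> forall x y : C, fmap F (0 : hom x y) = 0.
Proof. by move=> aF x y; apply: (addrI (fmap F 0)); rewrite -aF !addr0. Qed.

Lemma left_adjoint_inj (C D : category) (F : functor C D) (G : functor D C)
    (adj : adjunction F G) (x : C) (y : D) (f g : hom (F x) y) :
  fmap G f ∘ unit_of adj x = fmap G g ∘ unit_of adj x -> f = g.
Proof.
suff E (h : hom (F x) y) :
    h = counit_of adj y ∘ fmap F (fmap G h ∘ unit_of adj x).
  by move=> e; rewrite (E f) (E g) e.
by rewrite fmapM compA counit_nat -compA triangleL compm1.
Qed.

Lemma left_adjoint_additive (A B : abelian) (F : functor A B)
  (G : functor B A) : adjunction F G -> additive_functor F.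
Proof.
move=> adj.
have F0 x y : fmap F (0 : hom x y) = 0.
  have Fz (u : B) (f g : hom (F zero_ob) u) : f = g.
    apply: (left_adjoint_inj (adj := adj)).
    have [z _] := zero_obP A.
    by rewrite [LHS]z [RHS]z.
  have -> : (0 : hom x y) = (0 : hom zero_ob y) ∘ (0 : hom x zero_ob).
    by rewrite comp0m.
  by rewrite fmapM (Fz _ (fmap F 0) 0) comp0m.
have bip_ext x y (u : B) (f g : hom (F (bip x y)) u) :
    f ∘ fmap F (inl_m x y) = g ∘ fmap F (inl_m x y) ->
    f ∘ fmap F (inr_m x y) = g ∘ fmap F (inr_m x y) -> f = g.
  move=> el er; apply: (left_adjoint_inj (adj := adj)).
  have E w (i : hom w (bip x y)) (h : hom (F (bip x y)) u) :
      fmap G h ∘ unit_of adj _ ∘ i = fmap G (h ∘ fmap F i) ∘ unit_of adj w.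
    by rewrite -compA unit_nat compA -fmapM.
  by rewrite -[LHS]compm1 -[RHS]compm1 -bip_id !compDr !compA !E el er.
have bip_F x y : fmap F (inl_m x y) ∘ fmap F (prl_m x y)
    + fmap F (inr_m x y) ∘ fmap F (prr_m x y) = idm (F (bip x y)).
  apply: bip_ext; rewrite compDl -!compA -!fmapM.
    by rewrite prl_inl prr_inl compm0 compm1 F0 addr0 comp1m.
  by rewrite prl_inr prr_inr compm0 compm1 F0 add0r comp1m.
move=> x y f g.
pose h := f ∘ prl_m x x + g ∘ prr_m x x; pose dl := inl_m x x + inr_m x x.
have hl : h ∘ inl_m x x = f.
  by rewrite /h compDl -!compA prl_inl prr_inl compm0 compm1 addr0.
have hr : h ∘ inr_m x x = g.
  by rewrite /h compDl -!compA prl_inr prr_inr compm0 compm1 add0r.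
have dll : prl_m x x ∘ dl = idm x by rewrite compDr prl_inl prl_inr addr0.
have dlr : prr_m x x ∘ dl = idm x by rewrite compDr prr_inl prr_inr add0r.
have -> : f + g = h ∘ dl by rewrite compDr hl hr.
rewrite fmapM -[fmap F h]compm1 -bip_F compDr compDl !compA -!fmapM hl hr.
by rewrite -!compA dll dlr !compm1.
Qed.

Lemma right_adjoint_additive (A B : abelian) (F : functor A B)
  (G : functor B A) : adjunction F G -> additive_functor G.
Proof.
move=> adj x y.
exact: (@left_adjoint_additive (op B) (op A) _ _ (op_adjunction adj) y x).
Qed.

Section InAbelian.
Variable C : abelian.

Definition ker_lift (x y z : C) (g : hom y z) (f : hom x y) (e : g ∘ f = 0) :
    hom x (ker g) :=
  proj1_sig (constructive_indefinite_description _ (proj2 (kermP g) x f e)).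

Lemma ker_liftE (x y z : C) (g : hom y z) (f : hom x y) (e : g ∘ f = 0) :
  kerm g ∘ ker_lift e = f.
Proof.
by rewrite /ker_lift; case: constructive_indefinite_description => u [].
Qed.

Lemma kerm_mono (x y : C) (f : hom x y) : mono (kerm f).
Proof.
move=> z u v euv.
have e : f ∘ (kerm f ∘ v) = 0 by rewrite compA (proj1 (kermP f)) comp0m.
by have [w [_ wu]] := proj2 (kermP f) _ _ e; rewrite -(wu u euv) (wu v).
Qed.

(* [ker g / im f] for composable [x --f--> y --g--> z] with zero composite. *)
Definition homology (x y z : C) (g : hom y z) (f : hom x y) (e : g ∘ f = 0) :
    C := coker (ker_lift e).

Definition exact (x y z : C) (f : hom x y) (g : hom y z) : Prop :=
  exists e : g ∘ f = 0, is_zero (homology e).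

(* An exact sequence [... -> r 2 -> r 1 -> r 0 -> x -> 0]. *)
Record resolution (x : C) := Resolution {
  res_ob :> nat -> C;
  res_d : forall i, hom (res_ob i.+1) (res_ob i);
  res_aug : hom (res_ob 0) x;
  res_exact : forall i, exact (res_d i.+1) (res_d i);
  res_exact0 : exact (res_d 0) res_aug;
  res_epi : epi res_aug }.

Lemma res_dd (x : C) (r : resolution x) i : res_d r i ∘ res_d r i.+1 = 0.
Proof. by case: (res_exact r i). Qed.

Lemma exact_splice (x y z w : C) (p : hom y z) (m : hom z w)
    (q : hom x (ker p)) :
  mono m -> epi q -> exact (kerm p ∘ q) (m ∘ p).
Proof.
move=> mm eq.
have e : (m ∘ p) ∘ (kerm p ∘ q) = 0.
  by rewrite -compA (compA p) (proj1 (kermP p)) comp0m compm0.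
exists e.
have e1 : p ∘ kerm (m ∘ p) = 0.
  by apply: mm; rewrite compA (proj1 (kermP _)) compm0.
have e2 : (m ∘ p) ∘ kerm p = 0 by rewrite -compA (proj1 (kermP p)) compm0.
have ts : ker_lift e2 ∘ ker_lift e1 = idm _.
  by apply: kerm_mono; rewrite compA !ker_liftE compm1.
have el : epi (ker_lift e).
  have -> : ker_lift e = ker_lift e2 ∘ q.
    by apply: kerm_mono; rewrite ker_liftE compA ker_liftE.
  move=> u f g; rewrite !compA => /eq fg.
  by rewrite -[f]compm1 -[g]compm1 -ts !compA fg.
have id0 : idm (homology e) = 0.
  have c0 : cokerm (ker_lift e) = 0.
    by apply: el; rewrite (proj1 (cokermP _)) comp0m.
  have [u [_ uu]] :=
    proj2 (cokermP (ker_lift e)) (homology e) 0 (comp0m _ (ker_lift e)).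
  by rewrite -(uu (idm _) (etrans (comp1m _) c0)) -(uu 0 (comp0m _ _)).
by split=> y' f; [rewrite -[f]compm1 id0 compm0 | rewrite -[f]comp1m id0 comp0m].
Qed.

Definition projective_resolution (x : C) (r : resolution x) : Prop :=
  forall i, projective (r i).

Lemma projective_resolution_exists :
  enough_projectives C ->
  forall x, exists r : resolution x, projective_resolution r.
Proof.
move=> hC x.
pose P (y : C) := proj1_sig (constructive_indefinite_description _ (hC y)).
have PP y : exists e : hom (P y) y, projective (P y) /\ epi e.
  exact: (proj2_sig (constructive_indefinite_description _ (hC y))).
pose p y := proj1_sig (constructive_indefinite_description _ (PP y)).
have pP y : projective (P y) /\ epi (p y).
  exact: (proj2_sig (constructive_indefinite_description _ (PP y))).
pose syz := fix syz n := if n is n'.+1 then ker (p (syz n')) else x.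
pose d i : hom (P (syz i.+1)) (P (syz i)) := kerm (p (syz i)) ∘ p (syz i.+1).
have ex i : exact (d i.+1) (d i).
  by apply: exact_splice; [apply: kerm_mono | apply: (pP _).2].
have ex0 : exact (d 0%N) (p x).
  rewrite -[p x]comp1m; apply: exact_splice; last exact: (pP _).2.
  by move=> z f g; rewrite !comp1m.
by exists (@Resolution x (fun i => P (syz i)) d (p x) ex ex0 (pP x).2) => i;
  apply: (pP _).1.
Qed.

Fixpoint copower (n : nat) (x : C) : C :=
  if n is n'.+1 then bip x (copower n' x) else zero_ob.

Definition direct_summand (y z : C) : Prop :=
  exists y' : C, isomorphic (bip y y') z.

Definition in_add (x y : C) : Prop :=
  exists n : nat, direct_summand y (copower n x).

(* A finite exact sequence [0 -> r d -> ... -> r 0 -> c -> 0] is encoded as a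
   resolution continued by zero objects above degree [d]. *)
Definition in_res (d : nat) (x c : C) : Prop :=
  exists r : resolution c,
    (forall i, (i <= d)%N -> in_add x (r i)) /\
    (forall i, (d < i)%N -> is_zero (r i)).

End InAbelian.

Definition chosen_resolution (A : abelian) (hA : enough_projectives A)
    (x : A) : resolution x :=
  proj1_sig (constructive_indefinite_description _
    (projective_resolution_exists hA x)).

Lemma fmap_dd (A B : abelian) (F : functor A B) (aF : additive_functor F)
    (x : A) (r : resolution x) i :
  fmap F (res_d r i) ∘ fmap F (res_d r i.+1) = 0.
Proof. by rewrite -fmapM res_dd additive_functor0. Qed.

(* [L_i F (x) = H_i (F P)] for the chosen projective resolution [P] of [x]. *)
Definition left_derived (A B : abelian) (hA : enough_projectives A)
    (F : functor A B) (aF : additive_functor F) (i : nat) (x : A) : B :=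
  let P := chosen_resolution hA x in
  if i is j.+1 then homology (fmap_dd aF P j) else coker (fmap F (res_d P 0)).

Lemma op_enough (B : abelian) :
  enough_injectives B -> enough_projectives (op B).
Proof. by []. Qed.

(* An injective resolution in [B] is a projective resolution in [op B], and
   the homology of [z --f--> y --g--> x] formed in [op A] is the kernel of the
   map [coker f -> x] induced by [g]. *)
Definition right_derived (A B : abelian) (hB : enough_injectives B)
    (G : functor B A) (aG : additive_functor G) (i : nat) (y : B) : A :=
  @left_derived (op B) (op A) (op_enough hB) (op_functor G)
    (op_functor_additive aG) i y.

Section Fix.
Variables (A B : abelian).
Variables (hA : enough_projectives A) (hB : enough_injectives B).
Variables (F : functor A B) (G : functor B A) (adj : adjunction F G).

Let LF := left_derived hA (left_adjoint_additive adj).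
Let RG := right_derived hB (right_adjoint_additive adj).

Definition Fix0 (a : A) : Prop :=
  (forall i, (0 < i)%N -> is_zero (LF i a)) /\
  (forall i, (0 < i)%N -> is_zero (RG i (F a))) /\
  is_iso (unit_of adj a).

Definition coFix0 (b : B) : Prop :=
  (forall i, (0 < i)%N -> is_zero (RG i b)) /\
  (forall i, (0 < i)%N -> is_zero (LF i (G b))) /\
  is_iso (counit_of adj b).

End Fix.

(* Main.v *)
Require Import Defs.
From mathcomp Require Import all_boot all_algebra.
Import Defs.

Set Implicit Arguments.
Unset Strict Implicit.
Unset Printing Implicit Defensive.

Import GRing.Theory.
Local Open Scope ring_scope.
Local Open Scope cat_scope.

(* Vanishing of L_(n+1) F is rephrased without resolutions (Lvanish). Covering
   the middle term of a short exact sequence 0 -> K -> Y -> C -> 0 by a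
   projective rotates it into 0 -> Omega Y -> Omega C -> K -> 0, and rotating
   repeatedly replaces the long exact sequence: it gives, by induction on n, all
   the dimension shifting that is needed. For G one works in opposite categories.

   An add(X)-resolution is then handled one short exact sequence
   0 -> K -> Y -> C -> 0 with Y in add(X) at a time. In B, if K and Y are in
   coFix_0, then G keeps the sequence exact since R^1 G(K) = 0; as FG K -> FG Y
   is isomorphic to the mono K -> Y, it follows that G C is F-acyclic, and
   FG C -> C is the map of cokernels induced by two isomorphisms. In A, F keeps
   the sequence exact if C is F-acyclic. If G reflects zero objects, and K and Y
   are in Fix_0, then G kills ker (F K -> F Y) because GF K -> GF Y is isomorphic
   to K -> Y; so F K -> F Y is mono, and C is in Fix_0 as before. *)

(** * Short exact sequences and biproducts *)

Section Category.
Variable C : category.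

Lemma compNl (x y z : C) (g : hom y z) (f : hom x y) : (- g) ∘ f = - (g ∘ f).
Proof. by apply: (addrI (g ∘ f)); rewrite -compDl !subrr comp0m. Qed.

Lemma compNr (x y z : C) (g : hom y z) (f : hom x y) : g ∘ (- f) = - (g ∘ f).
Proof. by apply: (addrI (g ∘ f)); rewrite -compDr !subrr compm0. Qed.

Lemma mono_eq0 (x y : C) (m : hom x y) :
  mono m <-> forall z (f : hom z x), m ∘ f = 0 -> f = 0.
Proof.
split=> [mm z f mf0 | m0 z f g mfg]; first by apply: mm; rewrite mf0 compm0.
by apply/eqP; rewrite -subr_eq0; apply/eqP/m0; rewrite compDr compNr mfg subrr.
Qed.

Lemma split_mono (x y : C) (m : hom x y) (r : hom y x) : r ∘ m = idm x -> mono m.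
Proof.
by move=> rm z f g fg; rewrite -[f]comp1m -[g]comp1m -rm -!compA fg.
Qed.

Lemma mono_comp (x y z : C) (g : hom y z) (f : hom x y) :
  mono g -> mono f -> mono (g ∘ f).
Proof. by move=> mg mf w u v; rewrite -!compA => /mg/mf. Qed.

Lemma mono_cancel (x y z : C) (g : hom y z) (f : hom x y) :
  mono (g ∘ f) -> mono f.
Proof. by move=> mgf w u v fuv; apply: mgf; rewrite -!compA fuv. Qed.

Lemma is_iso_mono (x y : C) (f : hom x y) : is_iso f -> mono f.
Proof. by case=> g [gf _]; apply: split_mono gf. Qed.

Lemma is_zero_idm (x : C) : is_zero x <-> idm x = 0.
Proof.
split=> [[z _]|id0]; first exact: z.
by split=> y f; [rewrite -[f]compm1 id0 compm0 | rewrite -[f]comp1m id0 comp0m].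
Qed.

Lemma is_kernelP (x y k : C) (f : hom x y) (i : hom k x) :
  is_kernel f i <->
  [/\ f ∘ i = 0, mono i & forall z (g : hom z x), f ∘ g = 0 -> exists u, i ∘ u = g].
Proof.
split=> [[fi0 ui]|[fi0 mi li]]; split=> //.
- move=> z u v iuv; have e : f ∘ (i ∘ u) = 0 by rewrite compA fi0 comp0m.
  by have [w [_ uw]] := ui _ _ e; rewrite -(uw u) // -(uw v).
- by move=> z g /ui[u [iu _]]; exists u.
- move=> z g /li[u iu]; exists u; split=> // v iv.
  by apply: mi; rewrite iu iv.
Qed.

Lemma is_kernel_monoE (x y z k : C) (f : hom x y) (m : hom y z) (i : hom k x) :
  mono m -> is_kernel (m ∘ f) i <-> is_kernel f i.
Proof.
move=> mm; split=> /is_kernelP[e mi li]; apply/is_kernelP; split=> //.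
- by apply: mm; rewrite compA e compm0.
- by move=> w g e'; apply: li; rewrite -compA e' compm0.
- by rewrite -compA e compm0.
- by move=> w g; rewrite -compA => e'; apply: li; apply: mm; rewrite e' compm0.
Qed.

(** Kernel and cokernel are both recorded, so the notion is self-dual: in the opposite category the
    two halves merely trade places. *)
Definition ses (k y c : C) (i : hom k y) (p : hom y c) : Prop :=
  is_kernel p i /\ is_cokernel i p.

Lemma ses_comp0 (k y c : C) (i : hom k y) (p : hom y c) : ses i p -> p ∘ i = 0.
Proof. by case=> - []. Qed.

Lemma ses_mono (k y c : C) (i : hom k y) (p : hom y c) : ses i p -> mono i.
Proof. by case=> /is_kernelP[]. Qed.

Lemma ses_lift (k y c : C) (i : hom k y) (p : hom y c) z (g : hom z y) :
  ses i p -> p ∘ g = 0 -> exists u, i ∘ u = g.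
Proof. by case=> /is_kernelP[_ _ li] _; apply: li. Qed.

(** A relation instead of the chosen [bip]: it is self-dual, invariant under isomorphism and
    preserved by additive functors, which need not send [bip] to [bip]. *)
Definition is_biproduct (x y b : C) : Prop :=
  exists (il : hom x b) (ir : hom y b) (pl : hom b x) (pr : hom b y),
  [/\ pl ∘ il = idm x, pr ∘ ir = idm y, pl ∘ ir = 0, pr ∘ il = 0 &
      il ∘ pl + ir ∘ pr = idm b].

Lemma is_biproduct_sym (x y b : C) : is_biproduct x y b -> is_biproduct y x b.
Proof.
move=> [il [ir [pl [pr [e1 e2 e3 e4 e5]]]]].
by exists ir, il, pr, pl; split=> //; rewrite addrC.
Qed.

Lemma is_biproduct_isor (x y b b' : C) :
  is_biproduct x y b -> isomorphic b b' -> is_biproduct x y b'.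
Proof.
move=> [il [ir [pl [pr [e1 e2 e3 e4 e5]]]]] [f [g [gf fg]]].
exists (f ∘ il), (f ∘ ir), (pl ∘ g), (pr ∘ g).
have K u v (p : hom b u) (i : hom v b) : p ∘ g ∘ (f ∘ i) = p ∘ i.
  by rewrite compA -(compA p) gf compm1.
by split; rewrite ?K // -!compA (compA il) (compA ir) -compDr -compDl e5 comp1m.
Qed.

Lemma is_biproduct_isol (x x' y b : C) :
  is_biproduct x y b -> isomorphic x x' -> is_biproduct x' y b.
Proof.
move=> [il [ir [pl [pr [e1 e2 e3 e4 e5]]]]] [f [g [gf fg]]].
exists (il ∘ g), ir, (f ∘ pl), pr; split=> //.
- by rewrite compA -(compA f) e1 compm1.
- by rewrite -compA e3 compm0.
- by rewrite compA e4 comp0m.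
- by rewrite compA -(compA il) gf compm1.
Qed.

Lemma is_biproduct_unique (x y b b' : C) :
  is_biproduct x y b -> is_biproduct x y b' -> isomorphic b b'.
Proof.
move=> [il [ir [pl [pr [e1 e2 e3 e4 e5]]]]].
move=> [il' [ir' [pl' [pr' [e1' e2' e3' e4' e5']]]]].
exists (il' ∘ pl + ir' ∘ pr), (il ∘ pl' + ir ∘ pr').
split; rewrite compDr !compDl -!compA.
  by rewrite !(compA pl') !(compA pr') e1' e2' e3' e4' !comp1m !comp0m !compm0 addr0 add0r.
by rewrite !(compA pl) !(compA pr) e1 e2 e3 e4 !comp1m !comp0m !compm0 addr0 add0r.
Qed.

Lemma is_biproduct_ses (x y b : C) : is_biproduct x y b ->
  exists (i : hom x b) (p : hom b y) (r : hom b x), ses i p /\ r ∘ i = idm x.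
Proof.
move=> [il [ir [pl [pr [e1 e2 e3 e4 e5]]]]]; exists il, pr, pl; split=> //; split.
  apply/is_kernelP; split=> //; first exact: split_mono e1.
  move=> z g prg; exists (pl ∘ g).
  by rewrite compA -[RHS]comp1m -e5 compDl -(compA ir) prg compm0 addr0.
split=> // z g gil; exists (g ∘ ir); split=> [|u <-].
  by rewrite -compA -[RHS]compm1 -e5 compDr !compA gil comp0m add0r.
by rewrite -compA e2 compm1.
Qed.

End Category.

Lemma epi_eq0 (C : category) (x y : C) (e : hom x y) :
  epi e <-> forall z (f : hom y z), f ∘ e = 0 -> f = 0.
Proof. exact: (@mono_eq0 (op_cat C)). Qed.

Lemma split_epi (C : category) (x y : C) (e : hom x y) (s : hom y x) :
  e ∘ s = idm y -> epi e.
Proof. exact: (@split_mono (op_cat C)). Qed.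

Lemma epi_comp (C : category) (x y z : C) (g : hom y z) (f : hom x y) :
  epi g -> epi f -> epi (g ∘ f).
Proof. by move=> mg mf; apply: (@mono_comp (op_cat C) z y x f g). Qed.

Lemma is_cokernelP (C : category) (x y c : C) (f : hom x y) (p : hom y c) :
  is_cokernel f p <->
  [/\ p ∘ f = 0, epi p & forall z (g : hom y z), g ∘ f = 0 -> exists u, u ∘ p = g].
Proof. exact: (@is_kernelP (op_cat C) y x c f p). Qed.

Lemma is_cokernel_epiE (C : category) (x y z c : C) (f : hom y z) (e : hom x y)
  (p : hom z c) : epi e -> is_cokernel (f ∘ e) p <-> is_cokernel f p.
Proof. exact: (@is_kernel_monoE (op_cat C) z y x c f e p). Qed.

Lemma op_ses (C : category) (k y c : C) (i : hom k y) (p : hom y c) :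
  ses i p -> @ses (op_cat C) c y k p i.
Proof. by case. Qed.

Lemma ses_epi (C : category) (k y c : C) (i : hom k y) (p : hom y c) :
  ses i p -> epi p.
Proof. by case=> _ /is_cokernelP[]. Qed.

Lemma ses_colift (C : category) (k y c : C) (i : hom k y) (p : hom y c) z
  (g : hom y z) : ses i p -> g ∘ i = 0 -> exists u, u ∘ p = g.
Proof. by case=> _ /is_cokernelP[_ _ li]; apply: li. Qed.

Lemma op_is_biproduct (C : category) (x y b : C) :
  is_biproduct x y b -> @is_biproduct (op_cat C) x y b.
Proof.
by move=> [il [ir [pl [pr [e1 e2 e3 e4 e5]]]]]; exists pl, pr, il, ir; split.
Qed.

(** * Exactness and resolutions *)

Section Abelian.
Variable C : abelian.

Lemma bip_is_biproduct (x y : C) : is_biproduct x y (bip x y).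
Proof.
exists (inl_m x y), (inr_m x y), (prl_m x y), (prr_m x y).
by split; rewrite ?prl_inl ?prr_inr ?prl_inr ?prr_inl ?bip_id.
Qed.

(** The epi [e] is the cokernel of some map, which factors through the kernel [i]; a map that kills
    [i] also kills that map and so descends along [e]. *)
Lemma epi_kernel_ses (k x y : C) (e : hom x y) (i : hom k x) :
  epi e -> is_kernel e i -> ses i e.
Proof.
move=> ee ke; split=> //; apply/is_cokernelP.
have [ei0 mi li] := proj1 (is_kernelP _ _) ke; split=> // z g gi0.
have [w [f /is_cokernelP[ef _ lf]]] := epi_normal ee.
by have [u iu] := li _ _ ef; apply: lf; rewrite -iu compA gi0 comp0m.
Qed.

Lemma kerm_ses (x y : C) (e : hom x y) : epi e -> ses (kerm e) e.
Proof. by move=> ee; apply: epi_kernel_ses => //; apply: kermP. Qed.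

End Abelian.

Lemma mono_cokernel_ses (C : abelian) (x y c : C) (m : hom x y) (p : hom y c) :
  mono m -> is_cokernel m p -> ses m p.
Proof.
move=> mm cm; apply: (@op_ses (op C)).
exact: (@epi_kernel_ses (op C) c y x m p).
Qed.

Section Exactness.
Variable C : abelian.

(** Both sequences end in [c], so the square [i ∘ t = s ∘ j] is a pullback and a pushout; this is
    its Mayer-Vietoris sequence. For projective [y] and [p] it is the sequence behind Schanuel's
    lemma. *)
Lemma ses_compare (k y c z p : C) (i : hom k y) (q : hom y c)
    (j : hom z p) (r : hom p c) (s : hom p y) (t : hom z k) :
  ses i q -> ses j r -> q ∘ s = r -> i ∘ t = s ∘ j ->
  ses (inl_m k p ∘ t - inr_m k p ∘ j) (i ∘ prl_m k p + s ∘ prr_m k p).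
Proof.
move=> iq jr qs it; set m := _ - _; set e := _ + _.
have el : e ∘ inl_m k p = i.
  by rewrite compDl -!compA prl_inl prr_inl compm1 compm0 addr0.
have er : e ∘ inr_m k p = s.
  by rewrite compDl -!compA prl_inr prr_inr compm1 compm0 add0r.
have em : e ∘ m = 0 by rewrite compDr compNr !compA el er it subrr.
have mr : prr_m k p ∘ m = - j.
  by rewrite compDr compNr !compA prr_inl prr_inr comp1m comp0m sub0r.
apply: epi_kernel_ses.
  apply/epi_eq0 => w h he.
  have [h' h'q] : exists h', h' ∘ q = h.
    by apply: (ses_colift iq); rewrite -el compA he comp0m.
  rewrite -h'q; suff -> : h' = 0 by rewrite comp0m.
  by apply: (proj1 (epi_eq0 _) (ses_epi jr)); rewrite -qs compA h'q -er compA he comp0m.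
apply/is_kernelP; split=> //.
  apply/mono_eq0 => w f mf0; apply: (proj1 (mono_eq0 _) (ses_mono jr)).
  by apply: oppr_inj; rewrite -compNl -mr -compA mf0 compm0 oppr0.
move=> w g eg.
have eab : i ∘ (prl_m k p ∘ g) = - (s ∘ (prr_m k p ∘ g)).
  by apply/eqP; rewrite -addr_eq0 !compA -compDl eg.
have [u ju] : exists u, j ∘ u = prr_m k p ∘ g.
  apply: (ses_lift jr); rewrite -qs -compA.
  by rewrite -[s ∘ _]opprK -eab compNr compA (ses_comp0 iq) comp0m oppr0.
have tu : prl_m k p ∘ g = - (t ∘ u).
  by apply: (ses_mono iq); rewrite eab -ju compNr !compA it.
(* The second component of [m] is [- j], whence the sign. *)
exists (- u); rewrite -[RHS]comp1m -bip_id compDl -!compA tu -ju.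
by rewrite /m !compNr compDl compNl opprD opprK -!compA.
Qed.

(** The difference map [d] is epi, hence the cokernel of its kernel. If [h ∘ v = 0], then
    [h ∘ prl_m k p] kills this kernel, whose first component factors through [v], so it equals some
    [g ∘ d]. Restricting to [p] gives [g ∘ e = 0], so [g = 0] and [h = 0]. *)
Lemma pullback_epi (w p k y : C) (v : hom w k) (w' : hom w p) (e : hom p y)
    (i : hom k y) :
  epi e -> i ∘ v = e ∘ w' ->
  (forall z (a : hom z k) (b : hom z p), i ∘ a = e ∘ b ->
     exists u, v ∘ u = a /\ w' ∘ u = b) ->
  epi v.
Proof.
move=> ee iv pb; apply/epi_eq0 => z h hv.
pose d := i ∘ prl_m k p - e ∘ prr_m k p.
have dl : d ∘ inl_m k p = i.
  by rewrite compDl compNl -!compA prl_inl prr_inl compm1 compm0 subr0.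
have dr : d ∘ inr_m k p = - e.
  by rewrite compDl compNl -!compA prl_inr prr_inr compm1 compm0 sub0r.
have ed : epi d.
  apply/epi_eq0 => t f fd; apply: (proj1 (epi_eq0 _) ee).
  by apply: oppr_inj; rewrite -compNr -dr compA fd comp0m oppr0.
have [|g gd] := ses_colift (z := z) (g := h ∘ prl_m k p) (kerm_ses ed).
  have : d ∘ kerm d = 0 by have [] := kermP d.
  rewrite compDl compNl -!compA => /eqP; rewrite subr_eq0 => /eqP/pb[u [vu _]].
  by rewrite -vu compA hv comp0m.
have g0 : g = 0.
  apply: (proj1 (epi_eq0 _) ee); apply: oppr_inj.
  by rewrite -compNr -dr compA gd -compA prl_inr compm0 oppr0.
by rewrite -[h]compm1 -(prl_inl k p) compA -gd g0 !comp0m.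
Qed.

(* Rotation: the syzygies of [y] and [c] along a cover of [y] form a short
   exact sequence ending in [k]. *)
Lemma ses_rotate (k y c z p : C) (i : hom k y) (q : hom y c)
    (j : hom z p) (e : hom p y) :
  ses i q -> ses j e ->
  exists (w : C) (l : hom w p) (u : hom z w) (v : hom w k),
  [/\ ses l (q ∘ e), ses u v, l ∘ u = j & i ∘ v = e ∘ l].
Proof.
move=> iq je.
have eqe : epi (q ∘ e) by apply: epi_comp (ses_epi iq) (ses_epi je).
have lqe := kerm_ses eqe; set l := kerm _ in lqe; exists (ker (q ∘ e)), l.
have [u lu] : exists u, l ∘ u = j.
  by apply: (ses_lift lqe); rewrite -compA (ses_comp0 je) compm0.
have [v iv] : exists v, i ∘ v = e ∘ l.
  by apply: (ses_lift iq); rewrite compA (ses_comp0 lqe).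
exists u, v; split=> //; apply: epi_kernel_ses.
  (* The square [i ∘ v = e ∘ l] is a pullback, so [v] is epi because [e] is. *)
  apply: (pullback_epi (ses_epi je) iv) => x a b iab.
  have [f lf] : exists f, l ∘ f = b.
    by apply: (ses_lift lqe); rewrite -compA -iab compA (ses_comp0 iq) comp0m.
  by exists f; split=> //; apply: (ses_mono iq); rewrite compA iv -compA lf.
apply/is_kernelP; split.
- by apply: (ses_mono iq); rewrite compA iv -compA lu (ses_comp0 je) compm0.
- by apply: (@mono_cancel _ _ _ _ l); rewrite lu; apply: ses_mono je.
move=> x g vg.
have [f jf] : exists f, j ∘ f = l ∘ g.
  by apply: (ses_lift je); rewrite compA -iv -compA vg compm0.
by exists f; apply: (ses_mono lqe); rewrite compA lu.
Qed.

(** If [h] kills [q], then [f] factors through the mono [m ∘ n], where [n] is the kernel of [h].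
    This mono is the kernel of some [g], which kills [f], hence factors through [p] and kills [m].
    So [m] factors through [m ∘ n], which splits [n] and forces [h = 0]. *)
Lemma cokernel_image_epi (x y c k : C) (f : hom x y) (p : hom y c) (m : hom k y)
    (q : hom x k) :
  is_cokernel f p -> is_kernel p m -> m ∘ q = f -> epi q.
Proof.
move=> /is_cokernelP[pf _ lp] /is_kernelP[pm mm lm] mq.
apply/epi_eq0 => z h hq.
have /is_kernelP[hn mn ln] := kermP h; set n := kerm h in hn mn ln.
have [q' nq'] := ln _ _ hq.
have [w [g /is_kernelP[gmn _ lg]]] := mono_normal (mono_comp mm mn).
have [g' g'p] : exists g', g' ∘ p = g.
  by apply: lp; rewrite -mq -nq' !compA -(compA g) gmn comp0m.
have [s ms] : exists s, (m ∘ n) ∘ s = m.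
  by apply: lg; rewrite -g'p -compA pm compm0.
have ns : n ∘ s = idm _ by apply: mm; rewrite compA ms compm1.
by rewrite -[h]compm1 -ns compA hn comp0m.
Qed.

Lemma is_zero_coker (x y : C) (h : hom x y) : is_zero (coker h) <-> epi h.
Proof.
have /is_cokernelP[ph pe lp] := cokermP h; split=> [[_ z]|eh].
  apply/epi_eq0 => w f /lp[u <-].
  by rewrite (z _ (cokerm h)) compm0.
apply/is_zero_idm; apply: pe; rewrite comp1m comp0m.
by apply: (proj1 (epi_eq0 _) eh).
Qed.

(** Any kernel of [g] is isomorphic to the chosen one, here via [s] and [t], so exactness can be
    tested on whichever factorization is at hand. *)
Lemma exact_epiE (x y z k : C) (f : hom x y) (g : hom y z) (i : hom k y)
    (q : hom x k) :
  is_kernel g i -> i ∘ q = f -> exact f g <-> epi q.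
Proof.
move=> /is_kernelP[gi mi li] iq.
have e0 : g ∘ f = 0 by rewrite -iq compA gi comp0m.
have [s ks] := li _ _ (proj1 (kermP g)).
have [t kt] : exists t, kerm g ∘ t = i.
  by have /is_kernelP[_ _ lk] := kermP g; apply: lk.
have ts : t ∘ s = idm _ by apply: (@kerm_mono _ _ _ g); rewrite compA kt ks compm1.
have st : s ∘ t = idm _ by apply: mi; rewrite compA ks kt compm1.
have E (e : g ∘ f = 0) : ker_lift e = t ∘ q.
  by apply: (@kerm_mono _ _ _ g); rewrite ker_liftE compA kt iq.
split=> [[e]|eq].
  rewrite /homology is_zero_coker E => etq.
  by rewrite -[q]comp1m -st -compA; apply: epi_comp etq; apply: split_epi st.
exists e0; rewrite /homology is_zero_coker E; apply: epi_comp => //.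
exact: split_epi ts.
Qed.

Lemma is_zero_homology (x y z : C) (f : hom x y) (g : hom y z) (e : g ∘ f = 0) :
  is_zero (homology e) <-> exact f g.
Proof.
by rewrite /homology is_zero_coker (exact_epiE (kermP g) (ker_liftE e)).
Qed.

Lemma exact_epi_cokernel (x y z : C) (f : hom x y) (g : hom y z) :
  exact f g -> epi g -> is_cokernel f g.
Proof.
move=> efg eg; have [e _] := efg; have [_ cg] := kerm_ses eg.
rewrite -(ker_liftE e); apply/is_cokernel_epiE => //.
exact: (proj1 (exact_epiE (kermP g) (ker_liftE e))).
Qed.

End Exactness.

Lemma kernel_coimage_mono (C : abelian) (x y c k : C) (f : hom x y) (i : hom k x)
    (p : hom x c) (m : hom c y) :
  is_kernel f i -> is_cokernel i p -> m ∘ p = f -> mono m.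
Proof. exact: (@cokernel_image_epi (op C) y x k c f i p m). Qed.

(** Exactness read from the cokernel side. A left adjoint preserves cokernels but not kernels in
    general, so this is the form that can be checked after applying [F]. *)
Lemma exact_cokernel_monoE (C : abelian) (x y z c : C) (f : hom x y)
    (p : hom y c) (m : hom c z) :
  is_cokernel f p -> exact f (m ∘ p) <-> mono m.
Proof.
move=> cp; have [pf ep lp] := proj1 (is_cokernelP _ _) cp.
split=> [ex|mm].
  have [e _] := ex; have k := kermP (m ∘ p).
  have eq := proj1 (exact_epiE k (ker_liftE e)) ex.
  apply: (kernel_coimage_mono k _ (erefl _)).
  by apply/(is_cokernel_epiE _ _ eq); rewrite ker_liftE.
have k := kermP p; have k' := proj2 (is_kernel_monoE p (kerm p) mm) k.
apply: (proj2 (exact_epiE k' (ker_liftE pf))).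
exact: (cokernel_image_epi cp k (ker_liftE pf)).
Qed.

(** * Resolutions as iterated short exact sequences *)

Section Resolutions.
Variable C : abelian.

Lemma aug_d (x : C) (r : resolution x) : res_aug r ∘ res_d r 0 = 0.
Proof. by case: (res_exact0 r). Qed.

Lemma tail_epi (x : C) (r : resolution x) : epi (ker_lift (aug_d r)).
Proof. exact: (proj1 (exact_epiE (kermP _) (ker_liftE _)) (res_exact0 r)). Qed.

Lemma tail_exact0 (x : C) (r : resolution x) :
  exact (res_d r 1) (ker_lift (aug_d r)).
Proof.
have ex := res_exact r 0; have [e _] := ex.
have k := kermP (res_d r 0).
apply: (proj2 (exact_epiE _ (ker_liftE e))).
  by apply/(is_kernel_monoE _ _ (kerm_mono (f := res_aug r))); rewrite ker_liftE.
exact: (proj1 (exact_epiE k (ker_liftE e)) ex).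
Qed.

Definition resolution_tail (x : C) (r : resolution x) :
    resolution (ker (res_aug r)) :=
  @Resolution C _ (fun i => r i.+1) (fun i => res_d r i.+1) (ker_lift (aug_d r))
    (fun i => res_exact r i.+1) (tail_exact0 r) (@tail_epi x r).

Section Cons.
Variables (k y c : C) (i : hom k y) (p : hom y c) (ip : ses i p).
Variable r : resolution k.

Definition cons_ob (n : nat) : C := if n is n'.+1 then r n' else y.

Definition cons_d (n : nat) : hom (cons_ob n.+1) (cons_ob n) :=
  match n return hom (cons_ob n.+1) (cons_ob n) with
  | 0 => i ∘ res_aug r
  | n'.+1 => res_d r n'
  end.

Lemma cons_exact n : exact (cons_d n.+1) (cons_d n).
Proof.
case: n => [|n]; last exact: res_exact.
(* At the splice, [res_aug r] is the cokernel of the differential before it, so exactness amounts to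
   [i] being mono. *)
apply/exact_cokernel_monoE; last exact: ses_mono ip.
exact: exact_epi_cokernel (res_exact0 r) (@res_epi _ _ r).
Qed.

Lemma cons_exact0 : exact (cons_d 0) p.
Proof.
by apply: (proj2 (exact_epiE (proj1 ip) (erefl _))); apply: res_epi.
Qed.

Definition resolution_cons : resolution c :=
  @Resolution C c cons_ob cons_d p cons_exact cons_exact0 (ses_epi ip).

End Cons.

Lemma exact_zero (x y z : C) (f : hom x y) (g : hom y z) : is_zero y -> exact f g.
Proof.
move=> zy; have e : g ∘ f = 0 by rewrite [g](proj1 zy) comp0m.
apply: (proj2 (exact_epiE (kermP g) (ker_liftE e))); apply/epi_eq0 => w h _.
rewrite -[h]compm1; suff -> : idm (ker g) = 0 by rewrite compm0.
by apply: (kerm_mono (f := g)); rewrite [LHS](proj2 zy) [RHS](proj2 zy).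
Qed.

Lemma epi_to_zero (x y : C) (f : hom x y) : is_zero y -> epi f.
Proof. by move=> [z _] w g h _; rewrite (z _ g) (z _ h). Qed.

Definition resolution_zero (c : C) (zc : is_zero c) : resolution c :=
  @Resolution C c (fun => zero_ob) (fun => 0) 0
    (fun=> exact_zero _ _ (zero_obP C)) (exact_zero _ _ (zero_obP C))
    (epi_to_zero zc).

(** Here [n] counts the terms in add([x]), and each unfolding passes to the next syzygy [k]. *)
Fixpoint res_length (x : C) (n : nat) (c : C) : Prop :=
  if n is n'.+1 then
    exists (k y : C) (i : hom k y) (p : hom y c),
      [/\ ses i p, in_add x y & res_length x n' k]
  else is_zero c.

Lemma in_res_length (d : nat) (x c : C) : in_res d x c <-> res_length x d.+1 c.
Proof.
(* Degrees 0 to [d] make [d.+1] terms. With both bounds written through [d.+1], the induction can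
   start from no terms at all, where [c] is zero. *)
have -> : in_res d x c <-> exists r : resolution c,
    (forall i, (i < d.+1)%N -> in_add x (r i)) /\
    (forall i, (d.+1 <= i)%N -> is_zero (r i)) by [].
elim: d.+1 c => [|n IHn] c; split.
- move=> [r [_ rz]]; apply/is_zero_idm; apply: (@res_epi _ _ r).
  by rewrite comp1m comp0m; apply: (proj1 (rz 0%N isT)).
- by move=> zc; exists (resolution_zero zc); split=> // i _; apply: zero_obP.
- move=> [r [radd rz]].
  exists (ker (res_aug r)), (r 0%N), (kerm (res_aug r)), (res_aug r); split.
  + exact: kerm_ses (@res_epi _ _ r).
  + exact: radd.
  + by apply/IHn; exists (resolution_tail r); split=> i; [exact: (radd i.+1) | exact: (rz i.+1)].
- move=> [k [y [i [p [ip yadd /IHn[r [radd rz]]]]]]].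
  by exists (resolution_cons ip r); split=> - [|j] //; [exact: (radd j) | exact: (rz j)].
Qed.

End Resolutions.

(** * Vanishing of derived functors *)

(** Transposition turns maps out of [F y] into maps out of [y], naturally, so the universal property
    of [p] transfers to [fmap F p]. *)
Lemma left_adjoint_cokernel (A B : abelian) (F : functor A B) (G : functor B A)
    (adj : adjunction F G) (x y c : A) (f : hom x y) (p : hom y c) :
  is_cokernel f p -> is_cokernel (fmap F f) (fmap F p).
Proof.
move=> /is_cokernelP[pf ep lp].
have F0 := additive_functor0 (left_adjoint_additive adj).
have G0 := additive_functor0 (right_adjoint_additive adj).
apply/is_cokernelP; split.
- by rewrite -fmapM pf F0.
- move=> z g h gh; apply: (left_adjoint_inj (adj := adj)); apply: ep.
  by rewrite -!compA unit_nat !compA -!fmapM gh.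
move=> z g gf.
have [u up] : exists u, u ∘ p = fmap G g ∘ unit_of adj y.
  by apply: lp; rewrite -compA unit_nat compA -fmapM gf G0 comp0m.
exists (counit_of adj z ∘ fmap F u).
by rewrite -compA -fmapM up fmapM compA counit_nat -compA triangleL compm1.
Qed.

Lemma right_adjoint_kernel (A B : abelian) (F : functor A B) (G : functor B A)
    (adj : adjunction F G) (k x y : B) (f : hom x y) (i : hom k x) :
  is_kernel f i -> is_kernel (fmap G f) (fmap G i).
Proof.
exact: (@left_adjoint_cokernel (op B) (op A) _ _ (op_adjunction adj) y x k f i).
Qed.

Lemma fmap_biproduct (A B : abelian) (F : functor A B) (x y b : A) :
  additive_functor F -> is_biproduct x y b -> is_biproduct (F x) (F y) (F b).
Proof.
move=> aF [il [ir [pl [pr [e1 e2 e3 e4 e5]]]]].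
exists (fmap F il), (fmap F ir), (fmap F pl), (fmap F pr).
by split; rewrite -!fmapM -?aF ?e1 ?e2 ?e3 ?e4 ?e5 ?fmap1 ?(additive_functor0 aF).
Qed.

Lemma fmap_zero (A B : abelian) (F : functor A B) (x : A) :
  additive_functor F -> is_zero x -> is_zero (F x).
Proof.
move=> aF /is_zero_idm x0; apply/is_zero_idm.
by rewrite -fmap1 x0 (additive_functor0 aF).
Qed.

Lemma is_biproduct_zero (A : abelian) (x y z : A) :
  is_zero z -> isomorphic x y -> is_biproduct x z y.
Proof.
move=> /is_zero_idm z0 [f [g [gf fg]]]; exists f, 0, g, 0.
by split; rewrite ?compm0 ?comp0m ?addr0 // z0.
Qed.

Lemma projective_retract (A : category) (p q : A) (i : hom q p) (r : hom p q) :
  r ∘ i = idm q -> projective p -> projective q.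
Proof.
move=> ri pp x y e ee f; have [g eg] := pp _ _ _ ee (f ∘ r).
by exists (g ∘ i); rewrite compA eg -compA ri compm1.
Qed.

Lemma ses_retraction (A : category) (k y p : A) (i : hom k y) (q : hom y p) :
  ses i q -> projective p -> exists r, r ∘ i = idm k.
Proof.
move=> iq pp; have [s qs] := pp _ _ _ (ses_epi iq) (idm p).
(* This difference is killed by [q]: it is the projection onto [k] given by the section [s]. *)
have [r ir] : exists r, i ∘ r = idm y - s ∘ q.
  by apply: (ses_lift iq); rewrite compDr compNr compm1 compA qs comp1m subrr.
exists r; apply: (ses_mono iq); rewrite compA ir compDl compNl comp1m -compA.
by rewrite (ses_comp0 iq) compm0 subr0 compm1.
Qed.

(** These closure properties pass membership from an object to its whole add-class. They include
    invariance under isomorphism, since isomorphic objects are summands of one another with zero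
    complement. *)
Definition add_closed (C : abelian) (P : C -> Prop) : Prop :=
  [/\ forall z, is_zero z -> P z,
      forall x y b, is_biproduct x y b -> P x -> P y -> P b &
      forall x y b, is_biproduct x y b -> P b -> P x].

Lemma add_closed_iso (C : abelian) (P : C -> Prop) (x y : C) :
  add_closed P -> isomorphic x y -> P y -> P x.
Proof.
move=> [_ _ sP] xy; apply: sP (is_biproduct_zero (zero_obP C) xy).
Qed.

Lemma add_closed_in_add (C : abelian) (P : C -> Prop) (x y : C) :
  add_closed P -> P x -> in_add x y -> P y.
Proof.
move=> [zP bP sP] Px [n [y' iso]].
apply: (sP _ _ _ (is_biproduct_isor (bip_is_biproduct y y') iso)).
elim: n {iso} => [|n IHn] /=; first exact: zP (zero_obP C).
exact: bP (bip_is_biproduct _ _) Px IHn.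
Qed.

Lemma add_closed_fmap (A B : abelian) (F : functor A B) (P : B -> Prop) :
  additive_functor F -> add_closed P -> add_closed (fun x => P (F x)).
Proof.
move=> aF [zP bP sP]; split=> [z /(fmap_zero aF)/zP | x y b /(fmap_biproduct aF) | x y b /(fmap_biproduct aF)] //.
  exact: bP.
exact: sP.
Qed.

Lemma add_closed_and (C : abelian) (P Q : C -> Prop) :
  add_closed P -> add_closed Q -> add_closed (fun x => P x /\ Q x).
Proof.
move=> [zP bP sP] [zQ bQ sQ]; split.
- by move=> z z0; split; [apply: zP | apply: zQ].
- by move=> x y b xyb [Px Qx] [Py Qy]; split; [apply: bP Px Py | apply: bQ Qx Qy].
- by move=> x y b xyb [Pb Qb]; split; [apply: sP xyb Pb | apply: sQ xyb Qb].
Qed.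

Lemma isomorphic_sym (C : category) (x y : C) : isomorphic x y -> isomorphic y x.
Proof. by move=> [f [g [gf fg]]]; exists g, f. Qed.

Lemma fmap_copower (A B : abelian) (F : functor A B) (x : A) (x' : B) n :
  additive_functor F -> isomorphic (F x) x' ->
  isomorphic (F (copower n x)) (copower n x').
Proof.
move=> aF Fx; elim: n => [|n IHn] /=.
  have /is_zero_idm F0 := fmap_zero aF (zero_obP A).
  have /is_zero_idm z0 := zero_obP B.
  by exists 0, 0; rewrite !comp0m F0 z0.
apply: is_biproduct_unique (bip_is_biproduct _ _).
apply: is_biproduct_isol Fx.
apply: is_biproduct_sym; apply: is_biproduct_isol IHn.
exact: is_biproduct_sym (fmap_biproduct aF (bip_is_biproduct _ _)).
Qed.

(** Allowing any [x'] isomorphic to [F x] lets this serve for [G] as well, where [G (F X)] is only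
    isomorphic to [X]. *)
Lemma fmap_in_add (A B : abelian) (F : functor A B) (x y : A) (x' : B) :
  additive_functor F -> isomorphic (F x) x' -> in_add x y -> in_add x' (F y).
Proof.
move=> aF Fx [n [y' iso]]; exists n, (F y').
apply: is_biproduct_unique (bip_is_biproduct _ _) _.
apply: is_biproduct_isor (fmap_copower n aF Fx).
apply: (fmap_biproduct aF).
exact: is_biproduct_isor (bip_is_biproduct _ _) iso.
Qed.

(** * Dimension shifting without resolutions *)

Section Vanishing.
Variables (A B : abelian) (F : functor A B) (G : functor B A).
Variable adj : adjunction F G.

Let aF : additive_functor F := left_adjoint_additive adj.

(* For [n = 0] this says that [L_1 F] vanishes at [a]; for larger [n], that
   [L_(n+1) F] does, by dimension shifting. *)
Fixpoint Lvanish (n : nat) (a : A) : Prop :=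
  if n is n'.+1 then
    forall (k p : A) (i : hom k p) (q : hom p a),
      ses i q -> projective p -> Lvanish n' k
  else
    forall (k y : A) (i : hom k y) (q : hom y a), ses i q -> mono (fmap F i).

(** One projective presentation decides. Comparing it with another sequence ending in [a] gives [m]
    with second component [- i], so [fmap F m] is mono. If [f] is killed by [fmap F i'], then its
    image in [F (bip k' p)] lifts along [fmap F m]; the second component of that image is zero, so
    the lift vanishes. *)
Lemma Lvanish0 (a k p : A) (i : hom k p) (q : hom p a) :
  ses i q -> projective p -> mono (fmap F i) -> Lvanish 0 a.
Proof.
move=> iq pp mi k' y i' q' iq'.
have [s qs] := pp _ _ _ (ses_epi iq') q.
have [t it] : exists t, i' ∘ t = s ∘ i.
  by apply: (ses_lift iq'); rewrite compA qs (ses_comp0 iq).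
have := ses_compare iq' iq qs it; set m := _ - _; set e := _ + _ => me.
have mr : prr_m k' p ∘ m = - i.
  by rewrite compDr compNr !compA prr_inl prr_inr comp1m comp0m sub0r.
have N0 z (g : hom z (F k)) : fmap F (prr_m k' p) ∘ (fmap F m ∘ g) = 0 -> g = 0.
  rewrite compA -fmapM mr => h; apply: (proj1 (mono_eq0 _) mi).
  have -> : fmap F i = - fmap F (- i).
    apply: (addIr (fmap F (- i))).
    by rewrite -aF addrN addNr (additive_functor0 aF).
  by rewrite compNl h oppr0.
have Fme : ses (fmap F m) (fmap F e).
  apply: mono_cokernel_ses; last exact: left_adjoint_cokernel adj _ _ _ _ _ (proj2 me).
  by apply/mono_eq0 => z g h; apply: N0; rewrite h compm0.
apply/mono_eq0 => z f i'f.
have [g mg] : exists g, fmap F m ∘ g = fmap F (inl_m k' p) ∘ f.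
  apply: (ses_lift Fme); rewrite compA -fmapM.
  by rewrite compDl -!compA prl_inl prr_inl compm1 compm0 addr0.
have g0 : g = 0.
  apply: N0; rewrite mg compA -fmapM prr_inl.
  by rewrite (additive_functor0 aF) comp0m.
rewrite -[f]comp1m -fmap1 -(prl_inl k' p) fmapM -compA -mg g0.
by rewrite !compm0.
Qed.

Lemma Lvanish_projective (n : nat) (p : A) : projective p -> Lvanish n p.
Proof.
elim: n p => [|n IHn] p pp k y i q iq; have [r ri] := ses_retraction iq pp.
  by apply: (split_mono (r := fmap F r)); rewrite -fmapM ri fmap1.
by move=> /(projective_retract ri); apply: IHn.
Qed.

Hypothesis hA : enough_projectives A.

Lemma projective_cover (a : A) :
  exists (k p : A) (i : hom k p) (q : hom p a), ses i q /\ projective p.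
Proof.
have [p [e [pp ee]]] := hA a.
by exists (ker e), p, (kerm e), e; split=> //; apply: kerm_ses.
Qed.

(** A chase replacing L_1 F(y) -> L_1 F(c) -> F(k) -> F(y). With [z] and [w] the syzygies of [y] and
    [c], a map into [F w] killed by [fmap F l] is killed by [fmap F v], as [fmap F i] is mono; so it
    comes from [F z], where [fmap F j] is mono. *)
Lemma Lvanish0_ses_right (k y c : A) (i : hom k y) (q : hom y c) :
  ses i q -> Lvanish 0 y -> mono (fmap F i) -> Lvanish 0 c.
Proof.
move=> iq Vy mi; have [z [p [j [e [je pp]]]]] := projective_cover y.
have [w [l [u [v [lqe uv lu iv]]]]] := ses_rotate iq je.
have mj := Vy _ _ _ _ je.
apply: (Lvanish0 lqe pp).
have mu : mono (fmap F u) by apply: (@mono_cancel _ _ _ _ (fmap F l)); rewrite -fmapM lu.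
have Fuv : ses (fmap F u) (fmap F v).
  exact: mono_cokernel_ses mu (left_adjoint_cokernel adj (proj2 uv)).
apply/mono_eq0 => x f lf.
have [g ug] : exists g, fmap F u ∘ g = f.
  apply: (ses_lift Fuv); apply: (proj1 (mono_eq0 _) mi).
  by rewrite compA -fmapM iv fmapM -compA lf compm0.
suff g0 : g = 0 by rewrite -ug g0 compm0.
apply: (proj1 (mono_eq0 _) mj).
by rewrite -lu fmapM -compA ug lf.
Qed.

Section Step.
Variable n : nat.

(** [ext] and [left] are the two induction hypotheses of [Lvanish_ext_left]. *)
Hypothesis ext : forall (k y c : A) (i : hom k y) (q : hom y c),
  ses i q -> Lvanish n k -> Lvanish n c -> Lvanish n y.
Hypothesis left : forall (k y c : A) (i : hom k y) (q : hom y c),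
  ses i q -> Lvanish n y -> Lvanish n.+1 c -> Lvanish n k.

(** Schanuel's argument: another syzygy [k'] of [a] is the kernel of an epi from [bip k p'] to the
    projective [p], so [ext] and then [left] move vanishing from [k] to [k']. *)
Lemma LvanishS_step (a k p : A) (i : hom k p) (q : hom p a) :
  ses i q -> projective p -> Lvanish n k -> Lvanish n.+1 a.
Proof.
move=> iq pp Vk k' p' i' q' iq' pp'.
have [s qs] := pp' _ _ _ (ses_epi iq) q'.
have [t it] : exists t, i ∘ t = s ∘ i'.
  by apply: (ses_lift iq); rewrite compA qs (ses_comp0 iq').
apply: (left (ses_compare iq iq' qs it)); last exact: Lvanish_projective.
have [j [r [_ [jr _]]]] := is_biproduct_ses (bip_is_biproduct k p').
by apply: ext jr Vk _; apply: Lvanish_projective.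
Qed.

(** By rotation, a syzygy of [c] is an extension of [k] by a syzygy of [y]. *)
Lemma Lvanish_right_step (k y c : A) (i : hom k y) (q : hom y c) :
  ses i q -> Lvanish n.+1 y -> Lvanish n k -> Lvanish n.+1 c.
Proof.
move=> iq Vy Vk; have [z [p [j [e [je pp]]]]] := projective_cover y.
have [w [l [u [v [lqe uv lu iv]]]]] := ses_rotate iq je.
by apply: (LvanishS_step lqe pp); apply: ext uv _ Vk; apply: Vy je pp.
Qed.

End Step.

(** The pieces of the long exact sequence around L_(n+1) F(y) and L_(n+1) F(k). They are proved
    together because rotation turns the first at [n.+1] into the second at [n], while the second at
    [n.+1] uses both at [n]. *)
Lemma Lvanish_ext_left (n : nat) :
  (forall (k y c : A) (i : hom k y) (q : hom y c),
    ses i q -> Lvanish n k -> Lvanish n c -> Lvanish n y) /\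
  (forall (k y c : A) (i : hom k y) (q : hom y c),
    ses i q -> Lvanish n y -> Lvanish n.+1 c -> Lvanish n k).
Proof.
elim: n => [|n [ext left]]; split=> k y c i q iq.
- move=> Vk Vc; have [z [p [j [e [je pp]]]]] := projective_cover y.
  have [w [l [u [v [lqe uv lu iv]]]]] := ses_rotate iq je.
  apply: (Lvanish0 je pp); rewrite -lu fmapM.
  by apply: mono_comp; [apply: Vc lqe | apply: Vk uv].
- move=> Vy Vc; have [z [p [j [e [je pp]]]]] := projective_cover y.
  have [w [l [u [v [lqe uv lu iv]]]]] := ses_rotate iq je.
  apply: (Lvanish0_ses_right uv); first exact: Vc lqe pp.
  by apply: (@mono_cancel _ _ _ _ (fmap F l)); rewrite -fmapM lu; apply: Vy je.
- move=> Vk Vc z p j e je pp.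
  have [w [l [u [v [lqe uv lu iv]]]]] := ses_rotate iq je.
  by apply: left uv _ Vk; apply: Vc lqe pp.
- move=> Vy Vc; have [z [p [j [e [je pp]]]]] := projective_cover y.
  have [w [l [u [v [lqe uv lu iv]]]]] := ses_rotate iq je.
  apply: (Lvanish_right_step ext left uv); first exact: Vc lqe pp.
  exact: Vy je pp.
Qed.

Lemma LvanishS (n : nat) (a k p : A) (i : hom k p) (q : hom p a) :
  ses i q -> projective p -> Lvanish n k -> Lvanish n.+1 a.
Proof. by have [ext left] := Lvanish_ext_left n; apply: LvanishS_step. Qed.

Lemma Lvanish_right (n : nat) (k y c : A) (i : hom k y) (q : hom y c) :
  ses i q -> Lvanish n.+1 y -> Lvanish n k -> Lvanish n.+1 c.
Proof. by have [ext left] := Lvanish_ext_left n; apply: Lvanish_right_step. Qed.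

Definition acyclic (a : A) : Prop := forall n, Lvanish n a.

Lemma acyclic_left (k y c : A) (i : hom k y) (q : hom y c) :
  ses i q -> acyclic y -> acyclic c -> acyclic k.
Proof.
by move=> iq Vy Vc n; apply: (proj2 (Lvanish_ext_left n)) iq (Vy n) (Vc n.+1).
Qed.

(** L_1 F(c) needs [fmap F i] to be mono; the higher ones lie between those of [y] and, one degree
    lower, those of [k]. *)
Lemma acyclic_right (k y c : A) (i : hom k y) (q : hom y c) :
  ses i q -> mono (fmap F i) -> acyclic k -> acyclic y -> acyclic c.
Proof.
move=> iq mi Vk Vy [|n]; first exact: Lvanish0_ses_right iq (Vy 0%N) mi.
exact: Lvanish_right iq (Vy n.+1) (Vk n).
Qed.

Lemma acyclic_ses (k y c : A) (i : hom k y) (q : hom y c) :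
  ses i q -> acyclic c -> ses (fmap F i) (fmap F q).
Proof.
move=> iq Vc; apply: mono_cokernel_ses (left_adjoint_cokernel adj (proj2 iq)).
exact: (Vc 0%N _ _ _ _ iq).
Qed.

Lemma acyclic_add_closed : add_closed acyclic.
Proof.
split.
- move=> z [z1 z2] n; apply: Lvanish_projective => x y e _ f.
  by exists 0; rewrite compm0 [RHS]z1.
- move=> x y b /is_biproduct_ses[i [p [_ [ip _]]]] Vx Vy n.
  exact: (proj1 (Lvanish_ext_left n)) ip (Vx n) (Vy n).
(* The two summands alternate: [x] is the quotient of [b] by [y], so vanishing for [x] at [n.+1]
   follows from vanishing for [y] at [n]. *)
- move=> x y b xyb Vb n; elim: n x y xyb => [|n IHn] x y xyb;
    have [i [p [r [ip ri]]]] := is_biproduct_ses (is_biproduct_sym xyb).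
    apply: (Lvanish0_ses_right ip (Vb 0%N)).
    by apply: (split_mono (r := fmap F r)); rewrite -fmapM ri fmap1.
  by apply: (Lvanish_right ip (Vb n.+1)); apply: IHn (is_biproduct_sym xyb).
Qed.

(** In the lowest degree, [F] preserves the cokernel through which [res_d r 0] factors, so exactness
    says that [F] keeps the first syzygy inclusion mono. Higher degrees reduce to the tail of
    [r]. *)
Lemma exact_fmap_Lvanish (n : nat) (x : A) (r : resolution x) :
  projective_resolution r ->
  exact (fmap F (res_d r n.+1)) (fmap F (res_d r n)) <-> Lvanish n x.
Proof.
elim: n x r => [|n IHn] x r pr.
  have kx : ses (kerm (res_aug r)) (res_aug r) by apply: kerm_ses; apply: res_epi.
  rewrite -(ker_liftE (aug_d r)) fmapM.
  have cq := exact_epi_cokernel (tail_exact0 r) (@tail_epi _ _ r).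
  rewrite (exact_cokernel_monoE _ (left_adjoint_cokernel adj cq)).
  by split=> [|Vx]; [apply: Lvanish0 kx (pr 0%N) | apply: Vx kx].
have kx : ses (kerm (res_aug r)) (res_aug r) by apply: kerm_ses; apply: res_epi.
rewrite (IHn _ (resolution_tail r) (fun i => pr i.+1)).
by split=> [|Vx]; [apply: LvanishS kx (pr 0%N) | apply: Vx kx (pr 0%N)].
Qed.

(** The proof [bF] of additivity is arbitrary, so that the lemma also applies to [right_derived],
    which carries the one obtained from [op_functor_additive]. *)
Lemma left_derived_acyclic (bF : additive_functor F) (x : A) :
  (forall i, (0 < i)%N -> is_zero (left_derived hA bF i x)) <-> acyclic x.
Proof.
have pr : projective_resolution (chosen_resolution hA x).
  by rewrite /chosen_resolution; case: ClassicalEpsilon.constructive_indefinite_description.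
split=> [Lx n|Vx [|n] // _].
  apply/(exact_fmap_Lvanish n pr).
  exact: (proj1 (is_zero_homology (fmap_dd bF _ n)) (Lx n.+1 isT)).
by apply/is_zero_homology/(exact_fmap_Lvanish n pr).
Qed.

End Vanishing.

(** * Fixed objects *)

(** By naturality, inverses on summands assemble to one on the biproduct, and an inverse on the
    biproduct compresses to each summand. *)
Lemma unit_iso_add_closed (A B : abelian) (F : functor A B) (G : functor B A)
    (adj : adjunction F G) : add_closed (fun x : A => is_iso (unit_of adj x)).
Proof.
have aF := left_adjoint_additive adj; have aG := right_adjoint_additive adj.
split.
- move=> z zz; exists 0; split; first by rewrite [RHS](proj1 zz) comp0m.
  by have /is_zero_idm -> := fmap_zero aG (fmap_zero aF zz); rewrite compm0.
- move=> x y b [il [ir [pl [pr [e1 e2 e3 e4 e5]]]]].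
  move=> [gx [gxu ugx]] [gy [gyu ugy]].
  exists (il ∘ gx ∘ fmap G (fmap F pl) + ir ∘ gy ∘ fmap G (fmap F pr)); split.
    rewrite compDl -!compA -!unit_nat !(compA gx) !(compA gy) gxu gyu.
    by rewrite !comp1m.
  rewrite compDr !compA !unit_nat -!(compA _ (unit_of _ _)) ugx ugy !compm1.
  by rewrite -!fmapM -aG -aF e5 !fmap1.
- move=> x y b [il [ir [pl [pr [e1 _ _ _ _]]]]] [g [gu ug]].
  exists (pl ∘ g ∘ fmap G (fmap F il)); split.
    by rewrite -compA -unit_nat compA -(compA pl) gu compm1.
  rewrite !compA unit_nat -(compA _ (unit_of _ _)) ug compm1 -!fmapM e1.
  by rewrite !fmap1.
Qed.

Lemma is_iso_op (C : category) (x y : C) (f : hom x y) :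
  is_iso f <-> @is_iso (op_cat C) y x f.
Proof. by split=> - [g [gf fg]]; exists g. Qed.

Lemma op_add_closed (C : abelian) (P : C -> Prop) :
  @add_closed (op C) P -> add_closed P.
Proof.
move=> [zP bP sP]; split.
- by move=> z [z1 z2]; apply: zP.
- by move=> x y b /op_is_biproduct; apply: bP.
- by move=> x y b /op_is_biproduct; apply: sP.
Qed.

Lemma counit_iso_add_closed (A B : abelian) (F : functor A B) (G : functor B A)
    (adj : adjunction F G) : add_closed (fun y : B => is_iso (counit_of adj y)).
Proof.
have [zP bP sP] := op_add_closed
  (@unit_iso_add_closed (op B) (op A) _ _ (op_adjunction adj)).
split.
- by move=> z /zP/is_iso_op.
- by move=> x y b xyb /is_iso_op Px /is_iso_op Py; apply/is_iso_op; apply: bP xyb Px Py.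
- by move=> x y b xyb /is_iso_op Pb; apply/is_iso_op; apply: sP xyb Pb.
Qed.

(** Since [a] is epi, [p'] is also a cokernel of [f' ∘ a = b ∘ f], so the inverse of [b] induces one
    for [g]. *)
Lemma cokernel_iso (C : category) (x y c x' y' c' : C)
    (f : hom x y) (p : hom y c) (f' : hom x' y') (p' : hom y' c')
    (a : hom x x') (b : hom y y') (g : hom c c') :
  is_cokernel f p -> is_cokernel f' p' -> epi a -> is_iso b ->
  b ∘ f = f' ∘ a -> g ∘ p = p' ∘ b -> is_iso g.
Proof.
move=> /is_cokernelP[pf ep _] /is_cokernelP[_ ep' lp'] ea [b' [b'b bb']] bf gp.
have [h hp] : exists h, h ∘ p' = p ∘ b'.
  apply: lp'; apply: ea.
  by rewrite -!compA -bf (compA b') b'b comp1m comp0m.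
exists h; split.
  by apply: ep; rewrite -compA gp compA hp -compA b'b compm1 comp1m.
by apply: ep'; rewrite -compA hp compA gp -compA bb' compm1 comp1m.
Qed.

(** With its dual, this draws invertibility of the unit and counit from the triangle identities. *)
Lemma is_iso_right_inverse (C : category) (x y : C) (f : hom x y) (g : hom y x) :
  is_iso f -> f ∘ g = idm y -> is_iso g.
Proof.
move=> [f' [f'f ff']] fg; exists f; split=> //.
suff -> : g = f' by [].
by rewrite -[g]comp1m -f'f -compA fg compm1.
Qed.

Lemma is_iso_left_inverse (C : category) (x y : C) (f : hom x y) (g : hom y x) :
  is_iso f -> g ∘ f = idm x -> is_iso g.
Proof.
move=> /is_iso_op fi gf; apply/is_iso_op.
exact: (@is_iso_right_inverse (op_cat C) y x f g).
Qed.

Lemma fmap_iso (C D : category) (F : functor C D) (x y : C) (f : hom x y) :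
  is_iso f -> is_iso (fmap F f).
Proof.
by move=> [g [gf fg]]; exists (fmap F g); rewrite -!fmapM gf fg !fmap1.
Qed.

Section Adjunction.
Variables (A B : abelian).
Variables (hA : enough_projectives A) (hB : enough_injectives B).
Variables (F : functor A B) (G : functor B A) (adj : adjunction F G).

Let aF : additive_functor F := left_adjoint_additive adj.
Let aG : additive_functor G := right_adjoint_additive adj.
Let opadj : @adjunction (op B) (op A) (op_functor G) (op_functor F) :=
  op_adjunction adj.

Let acyclicL (a : A) : Prop := acyclic F a.
Let acyclicR (b : B) : Prop := @acyclic (op B) (op A) (op_functor G) b.

Lemma Fix0P (a : A) :
  Fix0 hA hB adj a <->
  acyclicL a /\ acyclicR (F a) /\ is_iso (unit_of adj a).
Proof.
rewrite /Fix0 (left_derived_acyclic adj hA).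
have -> : (forall i, (0 < i)%N -> is_zero (right_derived hB aG i (F a))) <->
  acyclicR (F a); last by [].
rewrite /acyclicR -(@left_derived_acyclic (op B) (op A) _ _ opadj (op_enough hB)
  (op_functor_additive aG)).
(* Zero objects of [A] and of [op A] differ only in the order of the two conditions. *)
by split=> h i /h [].
Qed.

Lemma coFix0P (b : B) :
  coFix0 hA hB adj b <->
  acyclicR b /\ acyclicL (G b) /\ is_iso (counit_of adj b).
Proof.
rewrite /coFix0 (left_derived_acyclic adj hA).
have -> : (forall i, (0 < i)%N -> is_zero (right_derived hB aG i b)) <->
  acyclicR b; last by [].
rewrite /acyclicR -(@left_derived_acyclic (op B) (op A) _ _ opadj (op_enough hB)
  (op_functor_additive aG)).
by split=> h i /h [].
Qed.

Lemma acyclicL_add_closed : add_closed acyclicL.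
Proof. exact: acyclic_add_closed adj hA. Qed.

Lemma acyclicR_add_closed : add_closed acyclicR.
Proof. exact: op_add_closed (@acyclic_add_closed (op B) (op A) _ _ opadj hB). Qed.

Lemma acyclicR_right (k y c : B) (i : hom k y) (q : hom y c) :
  ses i q -> acyclicR k -> acyclicR y -> acyclicR c.
Proof.
move=> /op_ses iq Vk Vy.
exact: (@acyclic_left (op B) (op A) _ _ opadj hB _ _ _ _ _ iq).
Qed.

Lemma acyclicR_ses (k y c : B) (i : hom k y) (q : hom y c) :
  ses i q -> acyclicR k -> ses (fmap G i) (fmap G q).
Proof.
move=> /op_ses iq Vk.
have [] := @acyclic_ses (op B) (op A) _ _ opadj _ _ _ _ _ iq Vk.
by split.
Qed.

Lemma Fix0_add_closed : add_closed (Fix0 hA hB adj).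
Proof.
have [z b s] := add_closed_and acyclicL_add_closed
  (add_closed_and (add_closed_fmap aF acyclicR_add_closed) (unit_iso_add_closed adj)).
split=> [x zx | x y w xyw /Fix0P Px /Fix0P Py | x y w xyw /Fix0P Pw]; apply/Fix0P.
- exact: z.
- exact: b xyw Px Py.
- exact: s xyw Pw.
Qed.

Lemma coFix0_add_closed : add_closed (coFix0 hA hB adj).
Proof.
have [z b s] := add_closed_and acyclicR_add_closed
  (add_closed_and (add_closed_fmap aG acyclicL_add_closed) (counit_iso_add_closed adj)).
split=> [x zx | x y w xyw /coFix0P Px /coFix0P Py | x y w xyw /coFix0P Pw];
  apply/coFix0P.
- exact: z.
- exact: b xyw Px Py.
- exact: s xyw Pw.
Qed.

Lemma Fix0_coFix0 (a : A) : Fix0 hA hB adj a -> coFix0 hA hB adj (F a).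
Proof.
move=> /Fix0P[La [Ra ua]]; apply/coFix0P; split=> //; split.
  apply: add_closed_iso acyclicL_add_closed _ La.
  by apply: isomorphic_sym; exists (unit_of adj a).
exact: is_iso_left_inverse (fmap_iso F ua) (triangleL adj a).
Qed.

Lemma coFix0_Fix0 (b : B) : coFix0 hA hB adj b -> Fix0 hA hB adj (G b).
Proof.
move=> /coFix0P[Rb [Lb cb]]; apply/Fix0P; split=> //; split.
  by apply: add_closed_iso acyclicR_add_closed _ Rb; exists (counit_of adj b).
exact: is_iso_right_inverse (fmap_iso G cb) (triangleR adj b).
Qed.

(** * Transport of add(X)-resolutions along the adjunction *)

Variable X : A.
Hypothesis hX : Fix0 hA hB adj X.

Lemma GX : isomorphic (G (F X)) X.
Proof. by have /Fix0P[_ [_ uX]] := hX; apply: isomorphic_sym; exists (unit_of adj X). Qed.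

(** One induction serves both conclusions, as each rests on exactness of the image sequence
    [Giq]. *)
Lemma res_length_coFix0 (n : nat) (b : B) :
  res_length (F X) n b -> coFix0 hA hB adj b /\ res_length X n (G b).
Proof.
elim: n b => [|n IHn] b /=.
  by move=> zb; split; [case: coFix0_add_closed => h _ _; apply: h | apply: fmap_zero].
move=> [k [y [i [q [iq yadd /IHn[ck rk]]]]]].
have cy := add_closed_in_add coFix0_add_closed (Fix0_coFix0 hX) yadd.
have [Rk [Lk ek]] := proj1 (coFix0P _) ck.
have [Ry [Ly ey]] := proj1 (coFix0P _) cy.
have Giq := acyclicR_ses iq Rk.
split; last first.
  exists (G k), (G y), (fmap G i), (fmap G q); split=> //.
  exact: fmap_in_add aG GX yadd.
(* Followed by [counit_of adj y], this map becomes [i ∘ counit_of adj k], a composite of monos. *)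
have mi : mono (fmap F (fmap G i)).
  apply: (@mono_cancel _ _ _ _ (counit_of adj y)).
  by rewrite counit_nat; apply: mono_comp (is_iso_mono ek); apply: ses_mono iq.
apply/coFix0P; split; first exact: acyclicR_right iq Rk Ry.
split; first exact: (acyclic_right adj hA Giq mi Lk Ly).
apply: (cokernel_iso (left_adjoint_cokernel adj (proj2 Giq)) (proj2 iq) _ ey).
- by case: ek => g [_ gk]; apply: split_epi gk.
- exact: counit_nat.
- by rewrite counit_nat.
Qed.

(** Acyclicity descends to every syzygy, because the terms in add([X]) are acyclic; hence [F] keeps
    each short exact sequence exact. *)
Lemma res_length_acyclic (n : nat) (a : A) :
  acyclicL a -> res_length X n a -> res_length (F X) n (F a).
Proof.
have FX : isomorphic (F X) (F X) by exists (idm _), (idm _); rewrite comp1m.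
elim: n a => [|n IHn] a La /=; first exact: fmap_zero.
move=> [k [y [i [q [iq yadd rk]]]]].
exists (F k), (F y), (fmap F i), (fmap F q); split.
- exact: (acyclic_ses adj iq La).
- exact: fmap_in_add aF FX yadd.
apply: IHn => //; apply: (acyclic_left adj hA iq _ La).
have /Fix0P[LX _] := hX.
exact: add_closed_in_add acyclicL_add_closed LX yadd.
Qed.

Lemma res_length_Fix0 (n : nat) (a : A) :
  (forall b : B, is_zero (G b) -> is_zero b) ->
  res_length X n a -> Fix0 hA hB adj a.
Proof.
move=> G0; elim: n a => [|n IHn] a /=; first by case: Fix0_add_closed => h _ _; apply: h.
move=> [k [y [i [q [iq yadd /IHn fk]]]]].
have fy := add_closed_in_add Fix0_add_closed hX yadd.
have [Lk [Rk uk]] := proj1 (Fix0P _) fk.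
have [Ly [Ry uy]] := proj1 (Fix0P _) fy.
have mGF : mono (fmap G (fmap F i)).
  have [v [vu uv]] := uk.
  have -> : fmap G (fmap F i) = unit_of adj y ∘ i ∘ v.
    by rewrite unit_nat -compA uv compm1.
  apply: mono_comp; last exact: split_mono uv.
  by apply: mono_comp (is_iso_mono uy) _; apply: ses_mono iq.
have mF : mono (fmap F i).
  have [Gij mGj _] := proj1 (is_kernelP _ _) (right_adjoint_kernel adj (kermP (fmap F i))).
  (* [G] sends the kernel inclusion of [fmap F i] to a mono, and the mono [fmap G (fmap F i)] kills
     it, so its source is zero. *)
  have /G0/is_zero_idm z : is_zero (G (ker (fmap F i))).
    apply/is_zero_idm; apply: mGj; apply: mGF.
    by rewrite compm1 Gij !compm0.
  apply/mono_eq0 => w g ig.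
  have [u [<- _]] := proj2 (kermP (fmap F i)) _ _ ig.
  by rewrite -[u]comp1m z comp0m compm0.
have Fiq := mono_cokernel_ses mF (left_adjoint_cokernel adj (proj2 iq)).
have GFiq := acyclicR_ses Fiq Rk.
apply/Fix0P; split; first exact: (acyclic_right adj hA iq mF Lk Ly).
split; first exact: acyclicR_right Fiq Rk Ry.
apply: (cokernel_iso (proj2 iq) (proj2 GFiq) _ uy).
- by case: uk => g [_ gk]; apply: split_epi gk.
- exact: unit_nat.
- exact: unit_nat.
Qed.

Lemma adjoint_equivalence_restrict (P : A -> Prop) (Q : B -> Prop)
    (hF : forall x, P x -> Q (F x)) (hG : forall y, Q y -> P (G y)) :
  (forall x, P x -> Fix0 hA hB adj x) -> (forall y, Q y -> coFix0 hA hB adj y) ->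
  adjoint_equivalence (restrict_adjunction adj hF hG).
Proof.
move=> PF QF; split=> [[x Px] | [y Qy]].
  by have /Fix0P[_ [_]] := PF x Px.
by have /coFix0P[_ [_]] := QF y Qy.
Qed.

End Adjunction.

Theorem theorem5p10 (A B : abelian)
  (hA : enough_projectives A) (hB : enough_injectives B)
  (F : functor A B) (G : functor B A) (adj : adjunction F G)
  (X : A) (hX : Fix0 hA hB adj X) (d : nat) :
  restricts_to_equivalence adj (Fix0 hA hB adj) (coFix0 hA hB adj)
    (fun a : A => Fix0 hA hB adj a /\ in_res d X a)
    (fun b : B => in_res d (F X) b) /\
  ((forall b : B, is_zero (G b) -> is_zero b) ->
   (forall a : A, in_res d X a -> Fix0 hA hB adj a) /\
   restricts_to_equivalence adj (Fix0 hA hB adj) (coFix0 hA hB adj)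
     (fun a : A => in_res d X a)
     (fun b : B => in_res d (F X) b)).
Proof.
have Q'Q b : in_res d (F X) b -> coFix0 hA hB adj b.
  by move=> /in_res_length/(res_length_coFix0 hX)[].
have resF a : Fix0 hA hB adj a -> in_res d X a -> in_res d (F X) (F a).
  move=> /Fix0P[La _] /in_res_length ra; apply/in_res_length.
  exact: (res_length_acyclic hX).
have resG b : in_res d (F X) b -> in_res d X (G b).
  by move=> /in_res_length/(res_length_coFix0 hX)[_ ?]; apply/in_res_length.
split.
  split; first by move=> a [].
  split=> //.
  exists (fun a ha => resF a (proj1 ha) (proj2 ha)).
  exists (fun b hb => conj (coFix0_Fix0 (Q'Q b hb)) (resG b hb)).
  by apply: adjoint_equivalence_restrict Q'Q => a [].
move=> G0; have P'P a : in_res d X a -> Fix0 hA hB adj a.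
  by move=> /in_res_length; apply: res_length_Fix0.
split=> //; split=> //; split=> //.
exists (fun a ha => resF a (P'P a ha) ha), resG.
exact: adjoint_equivalence_restrict.
Qed.
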